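(* Let $m\ge 2$ be an integer, let $\lambda>0$ be real, and let $\mathcal{H}_\lambda^{\infty}$ be the $m$th-order infinite dimensional generalized Hilbert tensor. Then every $Z_1$-eigenvalue $\mu$ of $\mathcal{H}_\lambda^{\infty}$ satisfies $$|\mu|\le M(\lambda)=\begin{cases}\frac{\pi}{\sin(\lambda\pi)}, & 0<\lambda\le\frac12;\\[2pt] \pi, & \lambda>\frac12.\end{cases}$$
   Context: For real $\lambda$ not a non-positive integer, the $m$th-order infinite dimensional generalized Hilbert tensor $\mathcal{H}_\lambda^{\infty}$ is the array with entries $$\mathcal{H}_{i_1i_2\cdots i_m}=\frac{1}{i_1+i_2+\cdots+i_m+\lambda},\qquad i_1,\dots,i_m=0,1,2,\dots.$$ For a real sequence $x=(x_i)_{i\ge0}\in l^1$, $\mathcal{H}_\lambda^\infty x^{m-1}$ is the sequence with components $$(\mathcal{H}_\lambda^\infty x^{m-1})_i=\sum_{i_2,\dots,i_m=0}^{\infty}\frac{x_{i_2}\cdots x_{i_m}}{i+i_2+\cdots+i_m+\lambda},\qquad i=0,1,2,\dots.$$ A real number $\mu$ is a $Z_1$-eigenvalue of $\mathcal{H}_\lambda^\infty$ if there is a nonzero real sequence $x\in l^2$, belonging to $l^1$ so that the following expression is defined, with $$\|x\|_{l^1}^{2-m}\,\mathcal{H}_\lambda^\infty x^{m-1}=\mu x,$$ where $\|x\|_{l^1}=\sum_{i\ge0}|x_i|$. *)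

(* Defs.v *)
From mathcomp Require Import all_boot all_order all_algebra.
From mathcomp Require Import all_classical all_reals all_analysis.
Set Implicit Arguments.
Unset Strict Implicit.
Unset Printing Implicit Defensive.
Import Order.TTheory GRing.Theory Num.Theory.
Local Open Scope classical_set_scope.
Local Open Scope ring_scope.

(* Sum of an absolutely summable real family over an arbitrary index type:
   sum of the positive parts minus sum of the negative parts. On families that
   are not absolutely summable the value is meaningless. *)
Definition sum_family (R : realType) (T : choiceType) (f : T -> R) : R :=
  let g := EFin \o f in
  fine (\esum_(t in [set: T]) g^\+ t - \esum_(t in [set: T]) g^\- t)%E.

Definition in_l1 (R : realType) (x : nat -> R) : Prop :=
  (\sum_(0 <= i <oo) `|x i|%:E < +oo)%E.

Definition in_l2 (R : realType) (x : nat -> R) : Prop :=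
  (\sum_(0 <= i <oo) (`|x i| ^+ 2)%:E < +oo)%E.

Definition l1_norm (R : realType) (x : nat -> R) : R :=
  fine (\sum_(0 <= i <oo) `|x i|%:E)%E.

Definition hilbert_tensor (R : realType) (m : nat) (lambda : R)
    (i : m.-tuple nat) : R :=
  1 / ((\sum_(k < m) tnth i k)%N%:R + lambda).

(* [i :: t] is a (m.-1).+1-tuple, i.e., an m-tuple as soon as 0 < m. For x in
   l^1 and 0 < lambda the family is absolutely summable, its terms being
   bounded by lambda^-1 * \prod_k `|x t_k|. *)
Definition hilbert_apply (R : realType) (m : nat) (lambda : R) (x : nat -> R)
    (i : nat) : R :=
  sum_family (fun t : m.-1.-tuple nat =>
    hilbert_tensor lambda [tuple of i :: t] * \prod_(k < m.-1) x (tnth t k)).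

Definition Z1_eigenvalue (R : realType) (m : nat) (lambda mu : R) : Prop :=
  exists x : nat -> R,
    [/\ x <> (fun=> 0), in_l2 x, in_l1 x
      & forall i : nat,
          l1_norm x ^ (2%:Z - m%:Z) * hilbert_apply m lambda x i = mu * x i].

Definition hilbert_bound (R : realType) (lambda : R) : R :=
  if lambda <= 2^-1 then pi / sin (lambda * pi) else pi.

(* Main.v *)
Require Import Defs.
From mathcomp Require Import all_boot all_order all_algebra.
From mathcomp Require Import all_classical all_reals all_analysis.
From mathcomp Require Import ring lra.
Set Implicit Arguments.
Unset Strict Implicit.
Unset Printing Implicit Defensive.
Import Order.TTheory GRing.Theory Num.Theory.
Import numFieldNormedType.Exports.
Local Open Scope classical_set_scope.
Local Open Scope ring_scope.

(** Bounding [1 / (i + i2 + ... + im + lambda)] by [1 / (i + i2 + lambda)]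
    reduces the eigenvalue equation to [|mu| |x_i| <= sum_j |x_j| / (i + j + c)]
    with [c = min(lambda, 1/2)].  The weights [p_j = (c)_j / j!] are bounded, and
    [sum_j p_j / (i + j + c) <= pi / sin (c pi) * p_i]; summing the inequality
    against [p] therefore gives [|mu| <= pi / sin (c pi)].  The weight inequality
    telescopes in [i] down to [i = 0], where [c * sum_j p_j / (j + c)] is
    [2F1(c, c; c + 1; 1)]; Gauss's contiguity relation bounds it by
    [prod_k k^2 / (k^2 - c^2)], and Euler's sine product, obtained from the
    Wallis-type integrals of [cos (2 c t) cos^(2n) t] on [[0, pi/2]], concludes. *)

(** * Wallis-type integrals and Euler's sine product *)

(** Iterates [(N^2 - a^2) I_{n+1} = N (N - 1) I_n], with [N = 2n + 2], for the integrals [I_n] of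
    [cos (a t) cos^(2n) t] over [[0, pi/2]]; an explicit primitive stands for the integral. Leaving
    [b] abstract covers both [a = 0] and [a = 2 c]. *)
Lemma cos_power_primitive (R : realType) (a : R) (b : R -> R) (n : nat) :
  a ^+ 2 < 4 -> (forall t : R, is_derive t (1:R) b (cos (a * t))) -> b 0 = 0 ->
  exists F : R -> R,
    [/\ forall t : R, is_derive t (1:R) F (cos (a * t) * cos t ^+ n.*2), F 0 = 0
      & F (pi / 2) = b (pi / 2) * \prod_(k < n)
          (k.+1.*2%:R * k.*2.+1%:R / (k.+1.*2%:R ^+ 2 - a ^+ 2))].
Proof.
move=> a4 db b0; elim: n => [|n [F [dF F0 Fpi]]].
  by exists b; split=> // [t|]; rewrite ?big_ord0 ?expr0 mulr1.
set N : R := n.+1.*2%:R.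
have NE : N = n.*2%:R + 2 by rewrite /N doubleS -addn2 natrD.
have n0 : 0 <= n.*2%:R :> R by [].
have Na : N ^+ 2 - a ^+ 2 != 0 by rewrite gt_eqF// NE; nra.
(* Two integrations by parts give this formula; the last two terms vanish at [0] through the sines
   and at [pi / 2] through the powers of [cos t]. *)
pose G t := (N ^+ 2 - a ^+ 2)^-1 * (N * n.*2.+1%:R * F t
  + N * (cos (a * t) * cos t ^+ n.*2.+1 * sin t)
  - a * (sin (a * t) * cos t ^+ n.+1.*2)).
exists G; split.
- move=> t.
  have dat : is_derive t (1:R) (fun t : R => a * t) a.
    by apply: is_derive_eq; rewrite ?scaler0 ?add0r /GRing.scale/= mulr1.
  have dcat : is_derive t (1:R) (fun t : R => cos (a * t)) (- sin (a * t) * a).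
    exact: (@is_derive1_comp _ cos (fun t => a * t)).
  have dsat : is_derive t (1:R) (fun t : R => sin (a * t)) (cos (a * t) * a).
    exact: (@is_derive1_comp _ sin (fun t => a * t)).
  have dc k : is_derive t (1:R) (fun t : R => cos t ^+ k) (k%:R * cos t ^+ k.-1 * - sin t).
    have -> : (fun t : R => cos t ^+ k) = cos ^+ k by apply/funext => u; rewrite exprfctE.
    exact: is_deriveX.
  rewrite /G; apply: is_derive_eq.
  have s2 : sin t ^+ 2 = 1 - cos t ^+ 2.
    by rewrite -(cos2Dsin2 t) addrAC subrr add0r.
  rewrite /GRing.scale/= !(exprS _ n.*2.+1) !(exprS _ n.*2) -/N.
  have -> : n.*2.+1%:R = N - 1 by rewrite NE -natr1; ring.
  by field: s2.
- by rewrite /G F0 !mulr0 sin0 !mulr0 mul0r mulr0 subr0 addr0 mulr0.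
- rewrite /G Fpi cos_pihalf doubleS !expr0n/= !(mulr0, mul0r) subr0 addr0 big_ord_recr/=.
  by rewrite -/N; field.
Qed.

(** Since [cos (2 c t) <= 1], the integral of [cos (2 c t) cos^(2n) t] is at most that of
    [cos^(2n) t]. The quotient of their two reduction products is a partial product of Euler's
    formula. *)
Lemma sin_le_prod (R : realType) (c : R) (n : nat) : 0 < c < 1 ->
  sin (c * pi) * \prod_(k < n) (k.+1%:R ^+ 2 / (k.+1%:R ^+ 2 - c ^+ 2))
    <= pi * c.
Proof.
move=> /andP[c0 c1].
have a4 : (2 * c) ^+ 2 < 4 by nra.
have dF t : is_derive t (1 : R) (fun t => (2 * c)^-1 * sin (2 * c * t))
    (cos (2 * c * t)).
  have dat : is_derive t (1:R) (fun t : R => 2 * c * t) (2 * c).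
    by apply: is_derive_eq; rewrite /GRing.scale/= mulr1.
  have dsat : is_derive t (1:R) (fun t : R => sin (2 * c * t))
      (cos (2 * c * t) * (2 * c)).
    exact: (@is_derive1_comp _ sin (fun t => 2 * c * t)).
  by apply: is_derive_eq; rewrite /GRing.scale/=; field; rewrite gt_eqF.
have dG t : is_derive t (1 : R) id (cos (0 * t)).
  by rewrite mul0r cos0; exact: is_derive_id.
have [|F [dF' F0 Fpi]] := cos_power_primitive n a4 dF.
  by rewrite mulr0 sin0 mulr0.
have [||G [dG' G0 Gpi]] := cos_power_primitive (a := 0) n _ dG.
- by rewrite expr0n/= ltr0n.
- by [].
have dH t : is_derive t (1 : R) (G \- F) (cos (0 * t) * cos t ^+ n.*2
   - cos (2 * c * t) * cos t ^+ n.*2) by exact: is_deriveB.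
have pi0 : 0 < pi / 2 :> R by rewrite divr_gt0// pi_gt0.
(* Monotonicity of the integral: [G - F] vanishes at [0] and has derivative
   [(1 - cos (2 c t)) cos^(2n) t >= 0]. *)
have [|t _ /=] := MVT pi0 (fun t _ => dH t).
  apply: continuous_subspaceT => t; apply: differentiable_continuous.
  by apply/derivable1_diffP; case: (dH t).
rewrite F0 G0 subrr !subr0 => FG.
have : F (pi / 2) <= G (pi / 2).
  rewrite -subr_ge0 FG -mulrBl; apply: mulr_ge0; last exact: ltW.
  apply: mulr_ge0.
    by rewrite mul0r cos0 subr_ge0 cos_le1.
  by rewrite -muln2 mulnC exprM exprn_ge0// sqr_ge0.
rewrite Fpi Gpi.
(* The Wallis product is a positive factor common to both sides and cancels. *)
pose w := \prod_(k < n) (k.*2.+1%:R / k.+1.*2%:R) : R.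
have w0 : 0 < w by apply: prodr_gt0 => k _; rewrite divr_gt0.
have -> : \prod_(k < n) (k.+1.*2%:R * k.*2.+1%:R / (k.+1.*2%:R ^+ 2 - 0 ^+ 2)) = w.
  apply: eq_bigr => k _; rewrite expr0n/= subr0; field.
  by rewrite pnatr_eq0.
have -> : \prod_(k < n) (k.+1.*2%:R * k.*2.+1%:R / (k.+1.*2%:R ^+ 2 - (2 * c) ^+ 2))
   = w * \prod_(k < n) (k.+1%:R ^+ 2 / (k.+1%:R ^+ 2 - c ^+ 2)).
  rewrite -big_split/=; apply: eq_bigr => k _.
  have k1 : 1 <= k.+1%:R :> R by rewrite ler1n.
  rewrite -muln2 natrM; field.
  by rewrite !gt_eqF//; nra.
set P := \prod_(k < n) _ => le.
have {}le : (2 * c)^-1 * sin (2 * c * (pi / 2)) * P <= pi / 2.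
  by rewrite -(ler_pM2l w0) mulrCA [leRHS]mulrC.
have -> : c * pi = 2 * c * (pi / 2) by field.
have c2 : 0 < 2 * c by rewrite mulr_gt0.
rewrite -mulrA ler_pdivrMl// in le.
by apply: le_trans le _; rewrite le_eqVlt; apply/orP; left; apply/eqP; field.
Qed.

(** * Rising factorials and partial sums of [2F1(c, c; C; 1)] *)

Definition rising (R : realType) (a : R) (n : nat) : R :=
  \prod_(k < n) (a + k%:R).

Lemma risingS (R : realType) (a : R) n :
  rising a n.+1 = rising a n * (a + n%:R).
Proof. by rewrite /rising big_ord_recr. Qed.

Lemma rising_gt0 (R : realType) (a : R) n : 0 < a -> 0 < rising a n.
Proof. by move=> a0; apply: prodr_gt0 => k _; rewrite ltr_wpDr. Qed.

Lemma rising_shift (R : realType) (a : R) n :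
  a * rising (a + 1) n = rising a n * (a + n%:R).
Proof.
rewrite -risingS /rising big_ord_recl/= addr0; congr (_ * _).
by apply: eq_bigr => k _; rewrite /= /bump/= natrD addrA.
Qed.

(** The truncation to [J] terms of [2F1(c, c; C; 1)]. *)
Definition gauss_sum (R : realType) (c C : R) (J : nat) : R :=
  \sum_(j < J) rising c j ^+ 2 / (j`!%:R * rising C j).

(* Gauss's contiguity relation for 2F1(c, c; C; 1), whose truncation error
   telescopes with a favourable sign. *)
Lemma gauss_sum_shift (R : realType) (c C : R) (J : nat) : 0 < C ->
  C * (C - 2 * c) * gauss_sum c C J <= (C - c) ^+ 2 * gauss_sum c (C + 1) J.
Proof.
move=> C0.
have fn0 j : j`!%:R != 0 :> R by rewrite pnatr_eq0 -lt0n fact_gt0.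
have rn0 j : rising C j != 0 by rewrite gt_eqF// rising_gt0.
have Cn0 j : C + j%:R != 0 by rewrite gt_eqF// ltr_wpDr.
suff <- : C * (C - 2 * c) * gauss_sum c C J
    + C * J%:R * (rising c J ^+ 2 / (J`!%:R * rising C J))
    = (C - c) ^+ 2 * gauss_sum c (C + 1) J.
  rewrite lerDl; apply: mulr_ge0; first by apply: mulr_ge0 => //; exact: ltW.
  by rewrite divr_ge0 ?sqr_ge0// mulr_ge0// ltW// rising_gt0.
rewrite /gauss_sum; elim: J => [|J IH].
  by rewrite !big_ord0 !mulr0 mul0r addr0.
rewrite !big_ord_recr/= mulrDr [in RHS]mulrDr -IH.
have -> : rising (C + 1) J = rising C J * (C + J%:R) / C.
  by rewrite -rising_shift mulrAC divff ?mul1r// gt_eqF.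
rewrite !risingS factS natrM -natr1; field.
by rewrite fn0 rn0 Cn0 gt_eqF//= natr1 pnatr_eq0.
Qed.

(** Contiguity is iterated from [C = c + 1]. At [C = c + n + 1] its factor
    [(C - c)^2 / (C (C - 2 c))] equals [(n+1)^2 / ((n+1)^2 - c^2)]. *)
Lemma gauss_sum_le_prod (R : realType) (c : R) (J n : nat) : 0 < c < 1 ->
  gauss_sum c (c + 1) J <=
  \prod_(k < n) (k.+1%:R ^+ 2 / (k.+1%:R ^+ 2 - c ^+ 2))
    * gauss_sum c (c + 1 + n%:R) J.
Proof.
move=> /andP[c0 c1]; elim: n => [|n IH].
  by rewrite big_ord0 mul1r addr0.
apply: le_trans IH _; rewrite big_ord_recr/= -mulrA ler_wpM2l//.
  apply: prodr_ge0 => k _; have k1 : 1 <= k.+1%:R :> R by rewrite ler1n.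
  by rewrite divr_ge0// ?sqr_ge0//; nra.
have C0 : 0 < c + 1 + n%:R by rewrite ltr_wpDr// addr_gt0.
have := gauss_sum_shift c J C0.
have n0 : 0 <= n%:R :> R by [].
rewrite -!addrA natr1 !nat1r => h.
have k1 : 1 <= n.+1%:R :> R by rewrite ler1n.
rewrite mulrAC ler_pdivlMr; last by nra.
have -> : n.+1%:R ^+ 2 - c ^+ 2 = (c + n.+1%:R) * (c + (1 + (n%:R - 2 * c))).
  by rewrite -nat1r; ring.
have -> : n.+1%:R ^+ 2 = (c + (1 + (n%:R - c))) ^+ 2.
  by rewrite -nat1r; ring.
by rewrite mulrC.
Qed.

(** Every term except [j = 0] has [C] as a factor of its denominator, so for fixed [J] the excess
    over [1] is [O(1/C)]. *)
Lemma gauss_sum_le (R : realType) (c C : R) (J : nat) : 1 <= C ->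
  gauss_sum c C J <= 1 + (\sum_(j < J) rising c j ^+ 2 / j`!%:R) / C.
Proof.
move=> C1; have C0 : 0 < C by lra.
case: J => [|J]; rewrite /gauss_sum; first by rewrite !big_ord0 mul0r addr0.
have rC j : C <= rising C j.+1.
  elim: j => [|j IH]; first by rewrite /rising big_ord1 addr0.
  rewrite risingS (le_trans IH)// ler_peMr ?(ltW (rising_gt0 _ _))//.
  by rewrite ler_wpDr.
have f0 j : 0 < j`!%:R :> R by rewrite ltr0n fact_gt0.
rewrite !big_ord_recl/= /rising !big_ord0 fact0 expr1n mulr1 divr1 lerD2l.
rewrite mulrDl mulr_suml ler_wpDl// ?divr_ge0// ?(ltW C0)//.
apply: ler_sum => j _; rewrite invfM mulrA ler_wpM2l//.
  by rewrite divr_ge0// ?sqr_ge0// ltW.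
by rewrite lef_pV2 ?posrE ?rC ?rising_gt0.
Qed.

(** For fixed [J], let the number [n] of shifts grow: the shifted sum is at most [1] up to [O(1/n)],
    while the sine times the partial product stays below [pi * c]. *)
Lemma gauss_sum_sin_le (R : realType) (c : R) (J : nat) : 0 < c < 1 ->
  gauss_sum c (c + 1) J * sin (c * pi) <= pi * c.
Proof.
move=> c01; have /andP[c0 c1] := c01.
have s0 : 0 < sin (c * pi).
  by rewrite sin_gt0_pi// mulr_gt0 ?pi_gt0//= gtr_pMl ?pi_gt0.
set K := \sum_(j < J) rising c j ^+ 2 / j`!%:R.
have K0 : 0 <= K.
  by apply: sumr_ge0 => j _; rewrite divr_ge0 ?sqr_ge0.
have pc0 : 0 < pi * c :> R by rewrite mulr_gt0 ?pi_gt0.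
apply/ler_addgt0Pr => e e0.
(* Chosen so that the excess [pi * c * K / (c + 1 + n)] is at most [e]. *)
pose n := Num.truncn (pi * c * K / e).
have ne : pi * c * K / e < n.+1%:R by rewrite truncnS_gt.
have C0 : 0 < c + 1 + n%:R by rewrite ltr_wpDr// addr_gt0.
have le1 := gauss_sum_le_prod J n c01.
have le2 := sin_le_prod n c01.
have le3 : gauss_sum c (c + 1 + n%:R) J <= 1 + K / (c + 1 + n%:R).
  by apply: gauss_sum_le; rewrite -addrA nat1r ler_wpDl ?(ltW c0)// ler1n.
set P := (\prod_(k < n) _) in le1 le2.
apply: (@le_trans _ _ (pi * c * gauss_sum c (c + 1 + n%:R) J)).
  rewrite mulrC; apply: (le_trans (ler_wpM2l (ltW s0) le1)).
  rewrite mulrA ler_wpM2r//; apply: sumr_ge0 => j _.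
  by rewrite divr_ge0 ?sqr_ge0// mulr_ge0// ltW// rising_gt0.
apply: (le_trans (ler_wpM2l (ltW pc0) le3)).
rewrite mulrDr mulr1 lerD2l mulrA ler_pdivrMr// -ler_pdivrMl// mulrC ltW//.
by rewrite (lt_trans ne)// -natr1; lra.
Qed.

(** * The weights and their inequality for truncated sums *)

(** The Taylor coefficients of [(1 - z)^(-c)]. *)
Definition schur_weight (R : realType) (c : R) (j : nat) : R :=
  rising c j / j`!%:R.

Lemma schur_weight_gt0 (R : realType) (c : R) j : 0 < c ->
  0 < schur_weight c j.
Proof. by move=> c0; rewrite divr_gt0 ?rising_gt0// ltr0n fact_gt0. Qed.

Lemma schur_weight0 (R : realType) (c : R) : schur_weight c 0 = 1.
Proof. by rewrite /schur_weight /rising big_ord0 fact0 divr1. Qed.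

Lemma schur_weightS (R : realType) (c : R) j :
  j.+1%:R * schur_weight c j.+1 = (c + j%:R) * schur_weight c j.
Proof.
have f0 : j`!%:R != 0 :> R by rewrite pnatr_eq0 -lt0n fact_gt0.
have j0 : j.+1%:R != 0 :> R by rewrite pnatr_eq0.
rewrite -natr1 in j0.
by rewrite /schur_weight risingS factS natrM -natr1; field; rewrite f0 j0.
Qed.

Lemma schur_weight_le1 (R : realType) (c : R) j : 0 < c <= 1 ->
  schur_weight c j <= 1.
Proof.
move=> /andP[c0 c1]; elim: j => [|j IH]; first by rewrite schur_weight0.
rewrite -(ler_pM2l (ltr0Sn R j)) schur_weightS mulr1.
apply: (le_trans (ler_wpM2l _ IH)); first by rewrite addr_ge0// ltW.
by rewrite mulr1 -nat1r lerD2r.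
Qed.

(** The two sides differ by the boundary term [J p_J / (i + J + c) >= 0]. The factors [i + 1] and
    [c + i] are those of the recurrence [(i + 1) p_{i+1} = (c + i) p_i], so the weight inequality
    passes from [i] to [i + 1]. *)
Lemma hilbert_schur_shift (R : realType) (c : R) (i J : nat) : 0 < c ->
  i.+1%:R * \sum_(j < J) schur_weight c j / (i.+1%:R + j%:R + c) <=
  (c + i%:R) * \sum_(j < J) schur_weight c j / (i%:R + j%:R + c).
Proof.
move=> c0.
have n0 (k j : nat) : 0 < k%:R + j%:R + c by rewrite ltr_wpDl// addr_ge0.
suff -> : (c + i%:R) * \sum_(j < J) schur_weight c j / (i%:R + j%:R + c)
  = i.+1%:R * \sum_(j < J) schur_weight c j / (i.+1%:R + j%:R + c)
    + J%:R * schur_weight c J / (i%:R + J%:R + c).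
  rewrite lerDl divr_ge0//; last exact: ltW.
  by rewrite mulr_ge0// ltW// schur_weight_gt0.
elim: J => [|J IH]; first by rewrite !big_ord0 !(mulr0, mul0r) addr0.
rewrite !big_ord_recr/= !mulrDr IH schur_weightS.
have := n0 i J; have := n0 i.+1 J; have := n0 i J.+1.
rewrite -!natr1 => /lt0r_neq0 h1 /lt0r_neq0 h2 /lt0r_neq0 h3.
by field; rewrite ?h1 ?h2 ?h3.
Qed.

Lemma hilbert_schur_le (R : realType) (c : R) (i J : nat) : 0 < c < 1 ->
  \sum_(j < J) schur_weight c j / (i%:R + j%:R + c) <=
  pi / sin (c * pi) * schur_weight c i.
Proof.
move=> c01; have /andP[c0 c1] := c01.
have s0 : 0 < sin (c * pi).
  by rewrite sin_gt0_pi// mulr_gt0 ?pi_gt0//= gtr_pMl ?pi_gt0.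
elim: i => [|i IH].
  (* As [c (c+1)_j = (c)_j (c + j)], the numbers [c p_j / (j + c)] are the terms of
     [gauss_sum c (c + 1)]. *)
  rewrite schur_weight0 mulr1 ler_pdivlMr// -(ler_pM2l c0) [leRHS]mulrC.
  apply: le_trans (gauss_sum_sin_le J c01).
  rewrite mulrA ler_wpM2r ?(ltW s0)// mulr_sumr /gauss_sum.
  rewrite le_eqVlt; apply/orP; left; apply/eqP.
  apply: eq_bigr => j _.
  have f0 : j`!%:R != 0 :> R by rewrite pnatr_eq0 -lt0n fact_gt0.
  have cj : c + j%:R != 0 by rewrite gt_eqF// ltr_wpDr.
  have r0 : rising c j != 0 by rewrite gt_eqF// rising_gt0.
  have -> : rising (c + 1) j = rising c j * (c + j%:R) / c.
    by rewrite -rising_shift mulrAC divff ?mul1r// gt_eqF.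
  by rewrite /schur_weight add0r (addrC j%:R); field; rewrite ?f0 ?r0 ?cj ?gt_eqF.
rewrite -(ler_pM2l (ltr0Sn R i)) (le_trans (hilbert_schur_shift _ _ c0))//.
rewrite mulrCA schur_weightS mulrCA ler_wpM2l//.
by rewrite addr_ge0// ltW.
Qed.

(** * Sums over tuples and reduction to the matrix kernel *)

Lemma esumZl_le (R : realType) (T : choiceType) (r : R) (f : T -> \bar R) :
  0 <= r -> (forall t, 0 <= f t)%E ->
  (\esum_(t in [set: T]) (r%:E * f t) <= r%:E * \esum_(t in [set: T]) f t)%E.
Proof.
move=> r0 f0; apply: ge_ereal_sup => _ [A [finA _] <-].
rewrite -ge0_mule_fsumr//; apply: lee_wpmul2l; first by rewrite lee_fin.
by apply: ereal_sup_ubound; exists A.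
Qed.

(** Tonelli for nonnegative families, along the bijection [(j, t) |-> j :: t]. *)
Lemma esum_tuple_cons (R : realType) (n : nat)
    (f : n.+1.-tuple nat -> \bar R) : (forall t, 0 <= f t)%E ->
  (\esum_(t in [set: n.+1.-tuple nat]) f t =
   \sum_(0 <= j <oo) \esum_(t in [set: n.-tuple nat]) f [tuple of j :: t])%E.
Proof.
move=> f0; rewrite nneseries_esumT; last by move=> j; exact: esum_ge0.
rewrite esum_esum//.
rewrite (@reindex_esum _ _ _ ([set: nat] `*`` (fun=> [set: n.-tuple nat])) _
  (fun k : nat * n.-tuple nat => [tuple of k.1 :: k.2]))//.
split=> [//|[i s] [j t] _ _ /= /(congr1 val)/= [-> st]|t _].
  by congr (_, _); exact: val_inj.
by exists (thead t, [tuple of behead t]) => //=; rewrite -tuple_eta.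
Qed.

Lemma esum_tuple_prod_le (R : realType) (a : nat -> R) (L : R) (n : nat) :
  (forall i, 0 <= a i) -> (\sum_(0 <= i <oo) (a i)%:E <= L%:E)%E ->
  (\esum_(t in [set: n.-tuple nat]) (\prod_(k < n) a (tnth t k))%:E
    <= (L ^+ n)%:E)%E.
Proof.
move=> a0 aL.
have L0 : 0 <= L.
  by rewrite -lee_fin (le_trans _ aL)// nneseries_ge0// => i *; rewrite lee_fin.
elim: n => [|n IH].
  rewrite [X in esum X](_ : _ = [set [tuple]]).
    by rewrite esum_set1 ?lee_fin big_ord0.
  by apply/seteqP; split=> // t _ /=; rewrite tuple0.
rewrite esum_tuple_cons; last by move=> t; rewrite lee_fin prodr_ge0.
apply: (@le_trans _ _ (\sum_(0 <= j <oo) ((L ^+ n)%:E * (a j)%:E))%E).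
  apply: lee_nneseries => [j _ _|j _].
    by apply: esum_ge0 => t _; rewrite lee_fin prodr_ge0.
  rewrite [X in (X <= _)%E](_ : _ = \esum_(t in [set: n.-tuple nat])
     ((a j)%:E * (\prod_(k < n) a (tnth t k))%:E))%E; last first.
    apply: eq_esum => t _; rewrite -EFinM big_ord_recl tnth0; congr (_ * _)%:E.
    by apply: eq_bigr => k _; rewrite tnthS.
  apply: (le_trans (esumZl_le (a0 j) _)); first by move=> t; rewrite lee_fin prodr_ge0.
  by rewrite muleC; apply: lee_wpmul2r => //; rewrite lee_fin.
rewrite nneseriesZl; last by move=> j _; rewrite lee_fin.
by rewrite exprSr EFinM; apply: lee_wpmul2l => //; rewrite lee_fin exprn_ge0.
Qed.

Lemma normr_sum_family_le (R : realType) (T : choiceType) (f : T -> R) :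
  (`|sum_family f|%:E <= \esum_(t in [set: T]) `|f t|%:E)%E.
Proof.
rewrite /sum_family; set g := EFin \o f.
have -> : (\esum_(t in [set: T]) `|f t|%:E =
    \esum_(t in [set: T]) g^\+ t + \esum_(t in [set: T]) g^\- t)%E.
  rewrite -esumD//; apply: eq_esum => t _.
  by rewrite -[RHS]/((g^\+ \+ g^\-)%E t) -fune_abse.
have : (0 <= \esum_(t in [set: T]) g^\+ t)%E by exact: esum_ge0.
have : (0 <= \esum_(t in [set: T]) g^\- t)%E by exact: esum_ge0.
(* If either sum is [+oo], so is the right-hand side; nonnegativity excludes [-oo]. *)
case: (esum _ g^\+%E) => [p| |]; case: (esum _ g^\-%E) => [q| |]//=;
  rewrite ?leey ?normr0 ?lee_fin// => q0 p0.
by rewrite (le_trans (ler_normB _ _))// !ger0_norm.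
Qed.

(* All indices but one are dropped from the denominator, so that the remaining
   m sums only contribute the l^1 norm. *)
Lemma hilbert_apply_le (R : realType) (m : nat) (lambda L : R) (x : nat -> R)
    (i : nat) : 0 < lambda -> (\sum_(0 <= i <oo) `|x i|%:E <= L%:E)%E ->
  (`|hilbert_apply m.+2 lambda x i|%:E <=
   (L ^+ m)%:E * \sum_(0 <= j <oo) (`|x j| / (i%:R + j%:R + lambda))%:E)%E.
Proof.
move=> l0 xL; apply: (le_trans (normr_sum_family_le _)).
have L0 : 0 <= L.
  by rewrite -lee_fin (le_trans _ xL)// nneseries_ge0// => k *; rewrite lee_fin.
have n0 (k j : nat) : 0 < k%:R + j%:R + lambda by rewrite ltr_wpDl// addr_ge0.
rewrite esum_tuple_cons; last by move=> t; rewrite lee_fin.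
rewrite -nneseriesZl; last by move=> j _; rewrite lee_fin divr_ge0// ltW.
apply: lee_nneseries => [j _ _|j _].
  by apply: esum_ge0 => t _; rewrite lee_fin.
pose w := `|x j| / (i%:R + j%:R + lambda).
have w0 : 0 <= w by rewrite divr_ge0// ltW.
apply: (@le_trans _ _ (\esum_(t in [set: m.-tuple nat])
   (w%:E * (\prod_(k < m) `|x (tnth t k)|)%:E))%E).
  apply: le_esum => t _; rewrite -EFinM lee_fin normrM normr_prod.
  rewrite big_ord_recl tnth0 mulrA.
  under eq_bigr do rewrite tnthS.
  rewrite ler_wpM2r ?prodr_ge0// [leRHS]mulrC ler_wpM2r//.
  rewrite /hilbert_tensor !big_ord_recl tnth0 tnthS tnth0 div1r ger0_norm.
    rewrite lef_pV2 ?posrE//; last by rewrite ltr_wpDl.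
    by rewrite lerD2r -natrD ler_nat addnA leq_addr.
  by rewrite invr_ge0 addr_ge0// ltW.
apply: (le_trans (esumZl_le w0 _)); first by move=> t; rewrite lee_fin prodr_ge0.
rewrite muleC; apply: lee_wpmul2r; first by rewrite lee_fin.
exact: (@esum_tuple_prod_le _ (fun k => `|x k|)).
Qed.

(** * The Schur test and the eigenvalue bound *)

Lemma nneseries_hilbert_schur_le (R : realType) (c : R) (j : nat) : 0 < c < 1 ->
  (\sum_(0 <= i <oo) (schur_weight c i / (i%:R + j%:R + c))%:E <=
   (pi / sin (c * pi) * schur_weight c j)%:E)%E.
Proof.
move=> c01; have /andP[c0 c1] := c01.
apply: lime_le.
  apply: is_cvg_nneseries => i _ _.
  rewrite lee_fin divr_ge0// ltW ?schur_weight_gt0//.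
  by rewrite ltr_wpDl// addr_ge0.
apply: nearW => n; rewrite sumEFin lee_fin big_mkord.
under eq_bigr do rewrite (addrC _%:R).
exact: hilbert_schur_le.
Qed.

(* The Schur test in l^1-l^oo duality: the inequality is paired with the bounded
   positive eigenvector [schur_weight c]. *)
Lemma hilbert_subeigenvalue_le (R : realType) (c nu : R) (a : nat -> R) :
  0 < c < 1 -> 0 <= nu -> (forall i, 0 <= a i) -> (exists i, a i != 0) ->
  (\sum_(0 <= i <oo) (a i)%:E < +oo)%E ->
  (forall i, ((nu * a i)%:E <=
     \sum_(0 <= j <oo) (a j / (i%:R + j%:R + c))%:E)%E) ->
  nu <= pi / sin (c * pi).
Proof.
move=> c01 nu0 a0 [i0 ai0] aoo sub; have /andP[c0 c1] := c01.
have w0 i := schur_weight_gt0 i c0.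
have n0 (k j : nat) : 0 < k%:R + j%:R + c by rewrite ltr_wpDl// addr_ge0.
(* The pairing of [a] with the weights. It is finite because the weights are at most [1], and
   positive because some [a i] is nonzero, so it may be cancelled from
   [nu * A <= pi / sin (c * pi) * A]. *)
pose A := (\sum_(0 <= i <oo) (schur_weight c i * a i)%:E)%E.
have wa0 i : 0 <= schur_weight c i * a i by rewrite mulr_ge0// ltW.
have Aoo : (A < +oo)%E.
  apply: le_lt_trans aoo; apply: lee_nneseries => [i _ _|i _]; rewrite lee_fin//.
  by rewrite ler_piMl// schur_weight_le1// c0 ltW.
have A0 : (0 < A)%E.
  apply: lt_le_trans (nneseries_lim_ge i0.+1 _); last by move=> i *; rewrite lee_fin.
  rewrite sumEFin lte_fin big_nat_recr//= ltr_wpDl ?sumr_ge0// mulr_gt0//.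
  by rewrite lt0r ai0 a0.
have Afin : A \is a fin_num by rewrite ge0_fin_numE// ltW.
rewrite -lee_fin -(lee_pmul2r Afin A0).
apply: (@le_trans _ _ (\sum_(0 <= i <oo) \sum_(0 <= j <oo)
    (schur_weight c i * (a j / (i%:R + j%:R + c)))%:E)%E).
  rewrite /A -nneseriesZl; last by move=> i _; rewrite lee_fin.
  apply: lee_nneseries => [i _ _|i _]; first by rewrite -EFinM lee_fin mulr_ge0.
  rewrite -EFinM mulrCA EFinM.
  under eq_eseriesr do rewrite EFinM.
  rewrite nneseriesZl; last by move=> j _; rewrite lee_fin divr_ge0// ltW.
  by apply: lee_wpmul2l => //; rewrite lee_fin ltW.
have t0 i j : 0 <= schur_weight c i * (a j / (i%:R + j%:R + c)).
  by apply: mulr_ge0; [exact: ltW | apply: divr_ge0 => //; exact: ltW].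
(* Tonelli and the symmetry of the kernel move it from [a] onto the weights. *)
rewrite nneseries_interchange; last by move=> i j; rewrite lee_fin.
rewrite /A -nneseriesZl; last by move=> i _; rewrite lee_fin.
apply: lee_nneseries => [j _ _|j _].
  by apply: nneseries_ge0 => i _ _; rewrite lee_fin.
under eq_eseriesr do rewrite mulrCA EFinM.
rewrite nneseriesZl; last first.
  by move=> i _; rewrite lee_fin; apply: divr_ge0; exact: ltW.
rewrite -EFinM mulrA [X in (_ <= X%:E)%E]mulrC EFinM.
apply: lee_wpmul2l; first by rewrite lee_fin.
exact: nneseries_hilbert_schur_le.
Qed.

(** With order [m + 2] the normalising factor is [L^(-m)], which cancels exactly the [L^m] lost in
    [hilbert_apply_le]; [L > 0] because [x] is nonzero. *)
Lemma Z1_eigenvalue_sub (R : realType) (m : nat) (lambda mu : R) (x : nat -> R) :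
  0 < lambda -> in_l1 x -> (exists i, x i != 0) ->
  (forall i, l1_norm x ^ (2%:Z - m.+2%:Z) * hilbert_apply m.+2 lambda x i
     = mu * x i) ->
  forall i, ((`|mu| * `|x i|)%:E <=
    \sum_(0 <= j <oo) (`|x j| / (i%:R + j%:R + lambda))%:E)%E.
Proof.
move=> l0 x1 [i0 xi0] ev i; set L := l1_norm x in ev.
have LE : (\sum_(0 <= i <oo) `|x i|%:E)%E = L%:E.
  by rewrite /L /l1_norm fineK// ge0_fin_numE// nneseries_ge0.
have L0 : 0 < L.
  rewrite -lte_fin -LE.
  apply: lt_le_trans (nneseries_lim_ge i0.+1 _) => //.
  by rewrite sumEFin lte_fin big_nat_recr//= ltr_wpDl ?sumr_ge0// normr_gt0.
have Lm : 0 < L ^+ m by rewrite exprn_gt0.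
have HE : hilbert_apply m.+2 lambda x i = L ^+ m * (mu * x i).
  rewrite -ev (_ : 2%:Z - m.+2%:Z = - m%:Z); last by rewrite -addn2 PoszD; ring.
  by rewrite -exprnN mulVKf// gt_eqF.
rewrite -(@lee_pmul2l _ (L ^+ m)%:E)// ?lte_fin//.
rewrite -EFinM -normrM -[X in X * _](gtr0_norm Lm) -normrM -HE.
by apply: hilbert_apply_le => //; rewrite LE.
Qed.

Theorem theorem3p2 (R : realType) (m : nat) (lambda : R) (hm : (2 <= m)%N)
    (hlambda : 0 < lambda) (mu : R) (hmu : Z1_eigenvalue m lambda mu) :
  `|mu| <= hilbert_bound lambda.
Proof.
case: m hm hmu => [|[|m]]// _ [x [xn0 _ x1 ev]].
have {xn0}x0 : exists i, x i != 0.
  apply: contrapT => h; apply: xn0; apply/funext => i.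
  by apply: contrapT => /eqP xi; apply: h; exists i.
have sub := Z1_eigenvalue_sub hlambda x1 x0 ev.
(* Lowering the shift to [1/2] only enlarges the kernel and puts [c] in [(0, 1)]; at [c = 1/2] the
   bound [pi / sin (c * pi)] is [pi]. *)
pose c := Num.min lambda 2^-1.
have c0 : 0 < c by rewrite lt_min hlambda; lra.
have c1 : c < 1 by rewrite gt_min; apply/orP; right; lra.
have -> : hilbert_bound lambda = pi / sin (c * pi).
  rewrite /hilbert_bound /c; case: leP => // _.
  by rewrite (mulrC 2^-1) sin_pihalf divr1.
apply: (@hilbert_subeigenvalue_le _ c _ (fun i => `|x i|)) => //.
- by rewrite c0.
- by have [i xi] := x0; exists i; rewrite normr_eq0.
move=> i; apply: le_trans (sub i) _.
apply: lee_nneseries => [j _ _|j _]; rewrite lee_fin.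
  by rewrite divr_ge0// addr_ge0 ?addr_ge0// ltW.
rewrite ler_wpM2l// lef_pV2 ?posrE ?ltr_wpDl ?addr_ge0//.
by rewrite lerD2l ge_min lexx.
Qed.
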